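(* (i) If $N$ is a local loop near-ring, then the only idempotents of $N$ (elements $e\in N$ with $e\cdot e=e$) are $0$ and $1$. (ii) A loop near-ring $N$ is local if and only if $N\setminus U(N)$ is an $N$-subloop of $N$. Moreover, in this case $N\setminus U(N)$ is the unique maximal $N$-subloop of $N$. (iii) Let $\phi\colon N\to R$ be a non-trivial and unit-reflecting homomorphism from a loop near-ring $N$ to a ring $R$. If $N$ is local, then $\operatorname{im}\phi$ is a local subring of $R$. Conversely, if $R$ is a local ring, then $N$ is a local loop near-ring.
   Context: A loop is a set $G$ with a binary operation $+$ such that for all $a,b\in G$ the equations $a+x=b$ and $y+a=b$ have unique solutions $x,y\in G$, and there is a two-sided zero $0\in G$ ($0+a=a+0=a$ for all $a$). The solution of $a+x=b$ is the left difference of $a$ and $b$, and the solution of $y+a=b$ is the right difference. Addition need not be associative or commutative. A subloop is a subset closed under $+$ and both difference operations. A (right) loop near-ring $(N,+,\cdot)$ is a set $N$ with two binary operations such that $(N,+)$ is a loop, $(N,\cdot)$ is a monoid (with identity $1$), multiplication is right distributive over addition, i.e. $(a+b)c=ac+bc$ for all $a,b,c\in N$, and $n0=0$ for all $n\in N$. (Left distributivity is not assumed.) $U(N)$ is the group of invertible elements of the monoid $(N,\cdot)$. An $N$-subloop is a subloop $I$ of $(N,+)$ with $NI\subseteq I$. A maximal $N$-subloop is a maximal element, with respect to inclusion, among the proper $N$-subloops $J\lneq N$. A loop near-ring $N$ is local if it has a unique maximal $N$-subloop $J\lneq N$. A homomorphism of loop near-rings $\phi\colon N\to N'$ is a function with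 $\phi(1)=1$, $\phi(m+n)=\phi(m)+\phi(n)$ and $\phi(mn)=\phi(m)\phi(n)$ for all $m,n\in N$. It is unit-reflecting if $\phi(n)\in U(N')$ implies $n\in U(N)$. Rings are associative and unital, not necessarily commutative; every ring is a loop near-ring. The image of a homomorphism from a loop near-ring to a ring is a subring. A ring is local if it is nonzero and has a unique maximal left ideal. *)

(* Defs.v *)
From HB Require Import structures.
From mathcomp Require Import all_boot all_algebra.
From mathcomp Require Import boolp classical_sets.

Set Implicit Arguments.
Unset Strict Implicit.
Unset Printing Implicit Defensive.

Import GRing.Theory.
Local Open Scope classical_set_scope.
Local Open Scope ring_scope.

(* Addition is written [x + y], [0] (ring_scope) and multiplication            *)
(* [(x * y)%g], [1%g] (group_scope): these are MathComp's operations on        *)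
(* structures which carry no laws.                                             *)

HB.mixin Record BaseAddUMagma_isLoop (G : Type) of Algebra.BaseAddUMagma G := {
  loop_add0r : left_id (0 : G) +%R;
  loop_addr0 : right_id (0 : G) +%R;
  loop_ldiff : forall a b : G, exists! x, a + x = b;
  loop_rdiff : forall a b : G, exists! y, y + a = b
}.

#[short(type="loopType")]
HB.structure Definition Loop := {G of BaseAddUMagma_isLoop G & Algebra.BaseAddUMagma G}.

HB.mixin Record Loop_isLoopNearRing (N : Type) of Loop N & BaseUMagma N := {
  lnr_mulA : forall a b c : N, (a * (b * c) = (a * b) * c)%g;
  lnr_mul1 : forall a : N, (1 * a = a)%g;
  lnr_mulr1 : forall a : N, (a * 1 = a)%g;
  lnr_mulDl : forall a b c : N, ((a + b)%R * c)%g = (a * c)%g + (b * c)%g;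
  lnr_mulr0 : forall a : N, (a * 0%R)%g = 0
}.

#[short(type="loopNearRingType")]
HB.structure Definition LoopNearRing :=
  {N of Loop_isLoopNearRing N & Loop N & BaseUMagma N}.

(* A subloop is itself a loop, so it contains 0 (equivalently, the subset is   *)
(* nonempty).                                                                  *)
Definition subloop (G : loopType) (I : set G) : Prop :=
  [/\ I 0,
      forall a b, I a -> I b -> I (a + b),
      forall a b x, I a -> I b -> a + x = b -> I x
    & forall a b y, I a -> I b -> y + a = b -> I y].

Section LoopNearRingNotions.
Variable N : loopNearRingType.
Implicit Types (n u v : N) (I J K : set N).

Definition lnr_units : set N :=
  [set u | exists v, (u * v = 1)%g /\ (v * u = 1)%g].

Definition Nsubloop I : Prop :=
  subloop I /\ (forall n x, I x -> I (n * x)%g).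

Definition maximal_Nsubloop J : Prop :=
  [/\ Nsubloop J, J <> setT
    & forall K, Nsubloop K -> K <> setT -> J `<=` K -> K = J].

Definition local_lnr : Prop := exists! J, maximal_Nsubloop J.

End LoopNearRingNotions.

Arguments lnr_units : clear implicits.
Arguments local_lnr : clear implicits.

Record lnr_hom (N N' : loopNearRingType) := LnrHom {
  lnr_hom_fun :> N -> N';
  lnr_hom1 : lnr_hom_fun 1%g = 1%g;
  lnr_homD : forall m n, lnr_hom_fun (m + n) = lnr_hom_fun m + lnr_hom_fun n;
  lnr_homM : forall m n,
    lnr_hom_fun (m * n)%g = (lnr_hom_fun m * lnr_hom_fun n)%g
}.

Definition nontrivial_hom (N N' : loopNearRingType) (phi : lnr_hom N N') :=
  exists n, phi n <> 0.

Definition unit_reflecting (N N' : loopNearRingType) (phi : lnr_hom N N') :=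
  forall n, lnr_units N' (phi n) -> lnr_units N n.

(* An alias, so that declaring (1%g, *%g) to be the ring multiplication does   *)
(* not affect R itself.                                                        *)
Definition ring_lnr (R : pzRingType) : Type := R.

Section RingLoopNearRing.
Variable R : pzRingType.

HB.instance Definition _ := Algebra.BaseAddUMagma.copy (ring_lnr R) R.
HB.instance Definition _ := hasMul.Build (ring_lnr R) (@GRing.mul R).
HB.instance Definition _ := hasOne.Build (ring_lnr R) (@GRing.one R).

Fact ring_ldiff (a b : R) : exists! x, a + x = b.
Proof.
by exists (- a + b); split=> [|x <-]; [exact: addNKr|exact: addKr].
Qed.

Fact ring_rdiff (a b : R) : exists! y, y + a = b.
Proof.
by exists (b - a); split=> [|y <-]; [exact: subrK|exact: addrK].
Qed.

HB.instance Definition _ := BaseAddUMagma_isLoop.Build (ring_lnr R)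
  (@add0r R) (@addr0 R) ring_ldiff ring_rdiff.

HB.instance Definition _ := Loop_isLoopNearRing.Build (ring_lnr R)
  (@mulrA R) (@mul1r R) (@mulr1 R) (@mulrDl R) (@mulr0 R).

End RingLoopNearRing.

Section LocalRing.
Variable R : pzRingType.
Implicit Types I M K : set R.

Definition left_ideal I : Prop :=
  [/\ I 0, forall x y, I x -> I y -> I (x - y)
    & forall r x, I x -> I (r * x)].

Definition maximal_left_ideal M : Prop :=
  [/\ left_ideal M, M <> setT
    & forall K, left_ideal K -> K <> setT -> M `<=` K -> K = M].

End LocalRing.

Definition local_ring (R : pzRingType) : Prop :=
  (1 : R) <> 0 /\ exists! M : set R, maximal_left_ideal M.

Section Image.
Variables (N : loopNearRingType) (R : pzRingType).
Variable phi : lnr_hom N (ring_lnr R).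

Definition lnr_im : {pred R} := fun r : R => r \in range phi.

Fact lnr_im_subring : subring_closed lnr_im.
Proof.
have imP n : (phi n : R) \in lnr_im.
  by rewrite unfold_in; apply/mem_set; exists n.
split=> [|x y|x y].
- by rewrite -[1](lnr_hom1 phi).
- rewrite !unfold_in => /set_mem[m _ <-] /set_mem[n _ <-].
  have [d [hd _]] := loop_rdiff n m.
  suff -> : (phi m : R) - phi n = phi d by exact: imP.
  by rewrite -hd lnr_homD; exact: addrK.
- rewrite !unfold_in => /set_mem[m _ <-] /set_mem[n _ <-].
  by rewrite -[_ * _](lnr_homM phi); exact: imP.
Qed.

Definition lnr_im_ring : Type := {r : R | r \in lnr_im}.

HB.instance Definition _ := SubChoice.on lnr_im_ring.
HB.instance Definition _ :=
  GRing.SubChoice_isSubPzRing.Build R (mem lnr_im) lnr_im_ring lnr_im_subring.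

End Image.

(* Main.v *)
(** The principal left multiples [N x] form an N-subloop, and by Zorn's lemma
    every proper N-subloop lies in a maximal one; so if [J] is the only maximal
    N-subloop, every [x] outside [J] has a left inverse.  An idempotent [e] in
    [J] vanishes: write [1 = d + e]; then [e = d e + e] gives [d e = 0], while
    [d] is outside [J], hence left invertible.  If [y x = 1] with [x] outside
    [J], then [x y] is idempotent, so [y] in [J] would give [x y = 0] and
    [x = x y x = 0]; thus [y] is left invertible too and [x] is a unit.  Hence
    [J] is the set of non-units.  A unit-reflecting homomorphism pulls non-units
    back exactly to non-units, which transports locality in both directions,
    rings being particular loop near-rings whose N-subloops are the left
    ideals. *)
Require Import Defs.
From mathcomp Require Import all_boot all_algebra.
From mathcomp Require Import boolp classical_sets.

Set Implicit Arguments.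
Unset Strict Implicit.
Unset Printing Implicit Defensive.

Import GRing.Theory.
Local Open Scope classical_set_scope.
Local Open Scope ring_scope.

(** * Cancellation in loops *)

Section LoopTheory.
Context {G : loopType}.
Implicit Types a b x y : G.

Lemma loop_addIl a x y : a + x = a + y -> x = y.
Proof.
by have [d [_ dP]] := loop_ldiff a (a + y) => h;
  rewrite -(dP x h) -(dP y erefl).
Qed.

Lemma loop_addIr a x y : x + a = y + a -> x = y.
Proof.
by have [d [_ dP]] := loop_rdiff a (y + a) => h;
  rewrite -(dP x h) -(dP y erefl).
Qed.

End LoopTheory.

(** * N-subloops and the existence of maximal ones *)

Section NsubloopTheory.
Context {N : loopNearRingType}.
Implicit Types (x y e : N) (I J K : set N).

Lemma lnr_mul0r x : (0 * x = 0 :> N)%g.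
Proof.
apply: (@loop_addIl N (0 * x)%g).
by rewrite -lnr_mulDl !loop_addr0.
Qed.

Lemma Nsubloop_setT_1 I : Nsubloop I -> I 1%g -> I = setT.
Proof.
move=> [_ IM] I1; apply/seteqP; split=> // n _.
by rewrite -(lnr_mulr1 n); apply: IM.
Qed.

(** Reduces properness to a condition on the single element [1], which passes to unions of
    chains. *)
Lemma Nsubloop_proper I : Nsubloop I -> I <> setT <-> ~ I 1%g.
Proof.
move=> sI; split=> [IT /(Nsubloop_setT_1 sI)//|I1 IT].
by apply: I1; rewrite IT.
Qed.

Lemma Nsubloop_nonunits I : Nsubloop I -> I <> setT -> I `<=` ~` lnr_units N.
Proof.
move=> sI /(Nsubloop_proper sI) I1 x Ix [y [_ yx]].
by apply: I1; rewrite -yx; apply: sI.2.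
Qed.

Lemma Nsubloop_principal x : Nsubloop (range (fun n : N => (n * x)%g)).
Proof.
split; last by move=> n _ [m _ <-]; exists (n * m)%g; rewrite ?lnr_mulA.
split.
- by exists 0 => //; exact: lnr_mul0r.
- by move=> _ _ [m _ <-] [n _ <-]; exists (m + n); rewrite ?lnr_mulDl.
(* Differences are taken among the coefficients: by right distributivity [d * x] solves the same
   equation as [z], so cancellation identifies them. *)
- move=> _ _ z [m _ <-] [n _ <-] h; have [d [hd _]] := loop_ldiff m n.
  exists d => //; apply: (@loop_addIl N (m * x)%g).
  by rewrite h -hd lnr_mulDl.
- move=> _ _ z [m _ <-] [n _ <-] h; have [d [hd _]] := loop_rdiff m n.
  exists d => //; apply: (@loop_addIr N (m * x)%g).
  by rewrite h -hd lnr_mulDl.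
Qed.

(** Members of a chain are comparable, so any two elements of the union lie in a common member,
    where closure applies. *)
Lemma Nsubloop_bigcup (F : set (set N)) :
  F !=set0 -> total_on F subset -> (forall I, F I -> Nsubloop I) ->
  Nsubloop (\bigcup_(I in F) I).
Proof.
move=> [I0 FI0] Ftot Fsub.
have ub a b : (\bigcup_(I in F) I) a -> (\bigcup_(I in F) I) b ->
    exists I, [/\ F I, I a & I b].
  move=> [I FI Ia] [K FK Kb]; case: (Ftot I K FI FK) => IK.
    by exists K; split=> //; apply: IK.
  by exists I; split=> //; apply: IK.
split; last by move=> n x [I FI Ix]; exists I => //; apply: (Fsub I FI).2.
split.
- by exists I0 => //; case: (Fsub I0 FI0) => -[].
- move=> a b aF bF; have [I [FI Ia Ib]] := ub a b aF bF.
  by exists I => //; case: (Fsub I FI) => -[_ ID _ _] _; apply: ID.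
- move=> a b x aF bF h; have [I [FI Ia Ib]] := ub a b aF bF.
  by exists I => //; case: (Fsub I FI) => -[_ _ IL _] _; apply: IL h.
- move=> a b x aF bF h; have [I [FI Ia Ib]] := ub a b aF bF.
  by exists I => //; case: (Fsub I FI) => -[_ _ _ IR] _; apply: IR h.
Qed.

Lemma maximal_Nsubloop_exists K : Nsubloop K -> K <> setT ->
  exists J, maximal_Nsubloop J /\ K `<=` J.
Proof.
move=> sK /(Nsubloop_proper sK) K1.
(* Adjoining [K] makes the empty chain admissible in [Zorn_bigcup]. *)
pose P (X : set N) := Nsubloop (K `|` X) /\ ~ (K `|` X) 1%g.
have Pchain (F : set (set N)) :
    F `<=` P -> total_on F subset -> P (\bigcup_(X in F) X).
  move=> FP Ftot; have [F0|/set0P nF] := eqVneq F set0.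
    by rewrite /P F0 bigcup_set0 setU0.
  have KF : K `|` \bigcup_(X in F) X =
      \bigcup_(I in [set K `|` X | X in F]) I.
    apply/seteqP; split=> x.
      case: nF => X FX [Kx|[Y FY Yx]].
        by exists (K `|` X); [exists X | left].
      by exists (K `|` Y); [exists Y | right].
    by move=> [_ [X FX <-] [Kx|Xx]]; [left | right; exists X].
  split; last first.
    by move=> [//|[X FX X1]]; apply: (FP X FX).2; right.
  rewrite KF; apply: Nsubloop_bigcup.
  - by case: nF => X FX; exists (K `|` X), X.
  - move=> _ _ [X FX <-] [Y FY <-].
    by case: (Ftot X Y FX FY) => XY; [left | right]; apply: setUS.
  - by move=> _ [X /FP[? _] <-].
have [A [[sA A1] Amax]] := Zorn_bigcup Pchain.
exists (K `|` A); split; last by move=> x; left.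
split=> //; first exact/Nsubloop_proper.
move=> L sL /(Nsubloop_proper sL) L1 AL.
(* Zorn's lemma makes [A] maximal for [P], not yet [K]|[A] among proper N-subloops; but a proper [L]
   above the latter absorbs [K], hence satisfies [P]. *)
have KL : K `|` L = L by apply/setUidPr => x Kx; apply: AL; left.
have PL : P L by rewrite /P KL.
apply/seteqP; split=> //; apply: contrapT => nLA; apply: (Amax L) => //.
split=> [|LA]; first by move=> x Ax; apply: AL; right.
by apply: nLA => x Lx; right; apply: LA.
Qed.

End NsubloopTheory.

(** * Locality, non-units and idempotents *)

Section LocalLoopNearRing.
Context {N : loopNearRingType}.
Implicit Types (x y e : N) (I J K : set N).

Section UniqueMaximal.
Variable J : set N.
Hypotheses (maxJ : maximal_Nsubloop J)
  (uniqJ : forall K, maximal_Nsubloop K -> J = K).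

Lemma left_inverse_notin_maximal x : ~ J x -> exists y, (y * x = 1)%g.
Proof.
move=> nJx; apply: contrapT => nx.
have sNx := Nsubloop_principal x.
have [|K [maxK NxK]] := maximal_Nsubloop_exists sNx.
  by apply/Nsubloop_proper => // -[y _ yx]; apply: nx; exists y.
apply: nJx; rewrite (uniqJ maxK); apply: NxK.
by exists 1%g; rewrite ?lnr_mul1.
Qed.

Lemma idempotent_in_maximal e : J e -> (e * e = e)%g -> e = 0.
Proof.
case: maxJ => sJ /(Nsubloop_proper sJ) J1 _ Je ee.
have [d [de1 _]] := loop_rdiff e 1%g.
have de0 : (d * e)%g = 0.
  apply: (@loop_addIr N e); rewrite loop_add0r.
  by rewrite -[X in _ + X]ee -lnr_mulDl de1 lnr_mul1.
have [Jd|z zd] := left_inverse_notin_maximal (x := d).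
  by apply: J1; rewrite -de1; case: sJ => -[_ JD _ _] _; apply: JD.
by rewrite -(lnr_mul1 e) -zd -lnr_mulA de0 lnr_mulr0.
Qed.

Lemma unit_notin_maximal x : ~ J x -> lnr_units N x.
Proof.
move=> nJx; have [y yx] := left_inverse_notin_maximal nJx.
have [sJ _ _] := maxJ.
have [Jy|w wy] := left_inverse_notin_maximal (x := y).
  have xy0 : (x * y)%g = 0.
    apply: idempotent_in_maximal; first exact: sJ.2.
    by rewrite lnr_mulA -(lnr_mulA x) yx lnr_mulr1.
  apply: nJx; rewrite -(lnr_mulr1 x) -yx lnr_mulA xy0 lnr_mul0r.
  by case: sJ => -[].
exists y; split=> //.
(* The left inverse [w] of [y] is [x] itself: [x = (w y) x = w (y x) = w]. *)
by rewrite -[x](lnr_mul1) -wy -(lnr_mulA w) yx lnr_mulr1.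
Qed.

Lemma unique_maximal_nonunits : J = ~` lnr_units N.
Proof.
case: maxJ => sJ JT _; apply/seteqP; split; first exact: Nsubloop_nonunits.
by move=> x nUx; apply: contrapT => /unit_notin_maximal.
Qed.

End UniqueMaximal.

Lemma lnr_units1 : lnr_units N 1%g.
Proof. by exists 1%g; rewrite lnr_mul1. Qed.

Lemma nonunits_maximal : Nsubloop (~` lnr_units N) ->
  maximal_Nsubloop (~` lnr_units N).
Proof.
move=> sM; split=> //.
  by apply/(Nsubloop_proper sM) => /(_ lnr_units1).
by move=> K sK KT MK; apply/seteqP; split=> //; apply: Nsubloop_nonunits.
Qed.

(** Every proper N-subloop consists of non-units, so a maximal one must fill the whole set. *)
Lemma maximal_nonunits J : Nsubloop (~` lnr_units N) ->
  maximal_Nsubloop J -> J = ~` lnr_units N.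
Proof.
move=> sM [sJ JT Jmax]; have [_ MT _] := nonunits_maximal sM.
by rewrite (Jmax _ sM MT) //; apply: Nsubloop_nonunits.
Qed.

Lemma local_lnrP : local_lnr N <-> Nsubloop (~` lnr_units N).
Proof.
split=> [[J [maxJ uniqJ]]|sM].
  by rewrite -(unique_maximal_nonunits maxJ uniqJ); case: maxJ.
exists (~` lnr_units N); split; first exact: nonunits_maximal.
by move=> K /(maximal_nonunits sM).
Qed.

Lemma local_lnr_idempotent e :
  local_lnr N -> (e * e = e)%g <-> e = 0 \/ e = 1%g.
Proof.
move=> [J [maxJ uniqJ]]; split=> [ee|[]->]; rewrite ?lnr_mulr0 ?lnr_mul1 //.
have [Je|nJe] := pselect (J e).
  by left; exact: (idempotent_in_maximal maxJ uniqJ).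
right; have [y [_ ye]] := unit_notin_maximal maxJ uniqJ nJe.
by rewrite -(lnr_mul1 e) -ye -lnr_mulA ee.
Qed.

End LocalLoopNearRing.

(** * Transport of locality along unit-reflecting homomorphisms *)

Section UnitReflecting.
Context {N N' : loopNearRingType}.
Variable phi : lnr_hom N N'.
Hypothesis phi_reflect : unit_reflecting phi.

Lemma lnr_hom0 : phi 0 = 0.
Proof.
by apply: (@loop_addIl N' (phi 0)); rewrite -lnr_homD !loop_addr0.
Qed.

(** One direction is unit reflection; the other holds because homomorphisms preserve inverses. *)
Lemma lnr_hom_nonunit n : (~` lnr_units N) n <-> (~` lnr_units N') (phi n).
Proof.
split=> nU U; apply: nU; first exact: phi_reflect.
by case: U => m [nm mn]; exists (phi m); rewrite -!lnr_homM nm mn lnr_hom1.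
Qed.

Lemma local_lnr_reflect : local_lnr N' -> local_lnr N.
Proof.
have nonU := lnr_hom_nonunit.
move=> /local_lnrP[[M0 MD ML MR] MM]; apply/local_lnrP.
split; last by move=> n x /nonU Mx; apply/nonU; rewrite lnr_homM; apply: MM.
split.
- by apply/nonU; rewrite lnr_hom0.
- by move=> a b /nonU Ma /nonU Mb; apply/nonU; rewrite lnr_homD; apply: MD.
- move=> a b x /nonU Ma /nonU Mb h; apply/nonU; apply: ML Ma Mb _.
  by rewrite -lnr_homD h.
- move=> a b y /nonU Ma /nonU Mb h; apply/nonU; apply: MR Ma Mb _.
  by rewrite -lnr_homD h.
Qed.

Lemma local_lnr_surjective :
  (forall y, exists x, phi x = y) -> local_lnr N -> local_lnr N'.
Proof.
move=> phi_surj /local_lnrP[[M0 MD ML MR] MM]; apply/local_lnrP.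
have nonU := lnr_hom_nonunit.
split; last first.
  move=> n' x'; have [[n <-] [x <-]] := (phi_surj n', phi_surj x').
  by rewrite -lnr_homM => /nonU Mx; apply/nonU/MM.
split.
- by rewrite -lnr_hom0; apply/nonU.
- move=> a' b'; have [[a <-] [b <-]] := (phi_surj a', phi_surj b').
  by rewrite -lnr_homD => /nonU Ma /nonU Mb; apply/nonU/MD.
- move=> a' b' x'; have [[a <-] [b <-]] := (phi_surj a', phi_surj b').
  (* The difference is formed in [N]; cancellation in [N'] shows that its image is [x']. *)
  move=> /nonU Ma /nonU Mb; have [d [hd _]] := loop_ldiff a b.
  rewrite -hd lnr_homD => /loop_addIl ->; apply/nonU; exact: ML hd.
- move=> a' b' x'; have [[a <-] [b <-]] := (phi_surj a', phi_surj b').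
  move=> /nonU Ma /nonU Mb; have [d [hd _]] := loop_rdiff a b.
  rewrite -hd lnr_homD => /loop_addIr ->; apply/nonU; exact: MR hd.
Qed.

End UnitReflecting.

(** * Rings as loop near-rings *)

Section RingCase.
Context {R : pzRingType}.

Lemma left_idealE (I : set R) :
  left_ideal I <-> Nsubloop (I : set (ring_lnr R)).
Proof.
split=> [[I0 IB IM]|[[I0 ID IL IR] IM]].
  have IN x : I x -> I (- x) by rewrite -sub0r; exact: IB.
  split=> //; split=> //.
  - by move=> a b Ia Ib; rewrite -[b]opprK; apply: IB => //; exact: IN.
  - move=> a b x Ia Ib ax; have <- : - a + b = x by rewrite -ax; exact: addKr.
    by rewrite addrC; apply: IB.
  - move=> a b y Ia Ib ya; have <- : b - a = y by rewrite -ya; exact: addrK.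
    exact: IB.
(* In a ring [x - y] is the right difference of [y] and [x]. *)
split=> // x y Ix Iy; apply: (IR y x) => //; exact: (@subrK R).
Qed.

Lemma maximal_left_idealE (I : set R) :
  maximal_left_ideal I <-> maximal_Nsubloop (I : set (ring_lnr R)).
Proof.
by split=> -[/left_idealE sI IT Imax]; split=> // K /left_idealE; apply: Imax.
Qed.

Lemma local_ringE : local_ring R <-> local_lnr (ring_lnr R).
Proof.
split=> [[_ [M [/maximal_left_idealE maxM uniqM]]]|[M [maxM uniqM]]].
  by exists M; split=> // K /maximal_left_idealE; apply: uniqM.
split; last first.
  exists M; split; first exact/maximal_left_idealE.
  by move=> K /maximal_left_idealE; apply: uniqM.
(* If [1 = 0], then [1] lies in [M], which is proper. *)
case: maxM => sM /(Nsubloop_proper sM) M1 _ R10; apply: M1.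
by rewrite [1%g]R10; case: sM => -[].
Qed.

End RingCase.

(** * Corestriction of a homomorphism to its image *)

Section Corestriction.
Context {N : loopNearRingType} {R : pzRingType}.
Variable phi : lnr_hom N (ring_lnr R).

Fact lnr_corestrict_subproof n : (phi n : R) \in lnr_im phi.
Proof. by rewrite unfold_in; apply/mem_set; exists n. Qed.

Definition lnr_corestrict_fun n : ring_lnr (lnr_im_ring phi) :=
  exist _ (phi n : R) (lnr_corestrict_subproof n).

(** Kept transparent, so that its underlying values reduce to those of [phi]. *)
Definition lnr_corestrict : lnr_hom N (ring_lnr (lnr_im_ring phi)).
Proof.
exists lnr_corestrict_fun => *; apply: val_inj.
- exact: (lnr_hom1 phi).
- exact: (lnr_homD phi).
- exact: (lnr_homM phi).
Defined.

Lemma lnr_corestrict_surj y : exists x, lnr_corestrict x = y.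
Proof.
case: y => r r_im; have := r_im.
rewrite unfold_in => /set_mem[n _ nr].
by exists n; apply: val_inj.
Qed.

(** An inverse inside the image is also an inverse in [R]. *)
Lemma lnr_corestrict_reflect :
  unit_reflecting phi -> unit_reflecting lnr_corestrict.
Proof.
move=> phi_reflect n [s [ns sn]]; apply: phi_reflect.
by exists (val s); split; [have := congr1 val ns | have := congr1 val sn].
Qed.

End Corestriction.

Theorem theorem1p7 (N : loopNearRingType) :
  (local_lnr N -> forall e : N, (e * e = e)%g <-> e = 0 \/ e = 1%g)
  /\
  ((local_lnr N <-> Nsubloop (~` lnr_units N))
   /\ (local_lnr N ->
         maximal_Nsubloop (~` lnr_units N)
         /\ forall J : set N, maximal_Nsubloop J -> J = ~` lnr_units N))
  /\
  (forall (R : pzRingType) (phi : lnr_hom N (ring_lnr R)),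
     nontrivial_hom phi -> unit_reflecting phi ->
     (local_lnr N ->
        subring_closed (lnr_im phi) /\ local_ring (lnr_im_ring phi))
     /\ (local_ring R -> local_lnr N)).
Proof.
split; first by move=> locN e; exact: local_lnr_idempotent.
split.
  split; first exact: local_lnrP.
  move=> /local_lnrP sM; split; first exact: nonunits_maximal.
  by move=> J; exact: maximal_nonunits.
move=> R phi _ phi_reflect; split=> [locN|/local_ringE].
  split; first exact: lnr_im_subring.
  apply/local_ringE.
  apply: (local_lnr_surjective (lnr_corestrict_reflect phi_reflect)) locN.
  exact: lnr_corestrict_surj.
exact: (local_lnr_reflect phi_reflect).
Qed.
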